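(* Let $\mathcal{M}'_m$ (resp. $\mathcal{M}''_m$) be a meridian surface of elliptic (resp. hyperbolic) type in $\mathbb{R}^4_1$ from the general class. (i) $\mathcal{M}'_m$ has constant mean curvature $\|H\|=a=\mathrm{const}$, $a\neq0$, if and only if the curve $c$ on $S^2(1)$ has constant spherical curvature $\kappa=\mathrm{const}=b$, $b\neq0$, and the meridian $m$ is determined by $\dot f=y(f)$, where $$y(t)=\sqrt{1+\frac{1}{t^2}\left(C\pm\frac t2\sqrt{b^2-4a^2t^2}\pm\frac{b^2}{4a}\arcsin\frac{2at}{b}\right)^2},\qquad C=\mathrm{const},$$ and $g(u)$ is defined by $\dot g(u)=\sqrt{\dot f^2(u)-1}$. (ii) $\mathcal{M}''_m$ has constant mean curvature $\|H\|=a=\mathrm{const}$, $a\neq0$, if and only if the curve $c$ on $S^2_1(1)$ has constant spherical curvature $\kappa=\mathrm{const}=b$, $b\neq0$, and the meridian $m$ is determined by $\dot f=y(f)$, where $$y(t)=\sqrt{1-\frac{1}{t^2}\left(C\pm\frac t2\sqrt{b^2-4a^2t^2}\pm\frac{b^2}{4a}\arcsin\frac{2at}{b}\right)^2},\qquad C=\mathrm{const},$$ and $g(u)$ is defined by $\dot g(u)=\sqrt{1-\dot f^2(u)}$.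
   Context: $\mathbb{R}^4_1$ is Minkowski 4-space with metric $\langle\cdot,\cdot\rangle$ of signature $(3,1)$ and orthonormal basis $e_1,e_2,e_3,e_4$, $\langle e_i,e_i\rangle=1$ for $i=1,2,3$, $\langle e_4,e_4\rangle=-1$. Dots denote $d/du$; $I,J\subset\mathbb{R}$ are intervals; all functions are smooth. Meridian surface of elliptic type: $\mathcal{M}'_m: z(u,v)=f(u)\,l(v)+g(u)\,e_4$, $u\in I$, $v\in J$, where $f>0$, $\dot f^2-\dot g^2=1$, and $c: l=l(v)$ is a smooth curve parameterized by arc length ($\langle l',l'\rangle=1$) on the unit sphere $S^2(1)$ centered at the origin of the Euclidean space $\mathrm{span}\{e_1,e_2,e_3\}$. Put $t=l'$ and let $n$ be a smooth unit vector field with $\{l,t,n\}$ an orthonormal frame of $\mathrm{span}\{e_1,e_2,e_3\}$; the spherical curvature of $c$ is $\kappa(v)=\langle t'(v),n(v)\rangle$. Meridian surface of hyperbolic type: $\mathcal{M}''_m: z(u,v)=f(u)\,l(v)+g(u)\,e_1$, $u\in I$, $v\in J$, where $f>0$, $\dot f^2+\dot g^2=1$, and $c: l=l(v)$ is a smooth curve with $\langle l',l'\rangle=1$ on the de Sitter space $S^2_1(1)=\{V:\langle V,V\rangle=1\}$ in $\mathrm{span}\{e_2,e_3,e_4\}$. Put $t=l'$ and let $n$ be a smooth vector field with $\langle n,n\rangle=-1$ and $\{l,t,n\}$ an orthonormal frame of $\mathrm{span}\{e_2,e_3,e_4\}$; the spherical curvature of $c$ is $\kappa(v)=\langle t'(v),n(v)\rangle$.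 Both are spacelike surfaces (the induced metric is Riemannian). The curve $m:u\mapsto(f(u),g(u))$ is the meridian curve, with curvature $\kappa_m=\dot f\ddot g-\dot g\ddot f$. The sign of $\dot g$ is normalized so that $\dot g=\sqrt{\dot f^2-1}$ in the elliptic case and $\dot g=\sqrt{1-\dot f^2}$ in the hyperbolic case. The surface is from the general class if $\kappa_m(u)\,\kappa(v)\neq0$ for all $u,v$. The mean curvature vector field is $H=\frac12\mathrm{tr}\,\sigma$, where $\sigma$ is the second fundamental tensor; it is assumed that $\langle H,H\rangle\neq0$, and the mean curvature is $\|H\|=\sqrt{\varepsilon\langle H,H\rangle}$ with $\varepsilon=\mathrm{sign}\langle H,H\rangle$. ''Determined by $\dot f=y(f)$'' means $\dot f(u)=y(f(u))$. In a formula with several $\pm$ signs, the upper signs or the lower signs are taken together.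
   Formalization: The claim is mended: a > 0; the derivative of f is assumed nonnegative; constant mean curvature includes <H,H> > 0 in (i) and <H,H> < 0 in (ii); b in the formula for y is replaced by |b|; t = f(u) must lie where the formula is defined. *)

(* Defs.v *)
From HB Require Import structures.
From mathcomp Require Import all_boot all_order all_algebra.
From mathcomp Require Import all_classical all_reals all_analysis.

Set Implicit Arguments.
Unset Strict Implicit.
Unset Printing Implicit Defensive.

Import Order.TTheory GRing.Theory Num.Theory.
Import numFieldNormedType.Exports.

Local Open Scope ring_scope.
Local Open Scope classical_set_scope.

Section Minkowski.
Variable R : realType.
Local Notation R41 := 'rV[R]_4.

(* Coordinates are numbered from 0, so the timelike direction is [ord_max]. *)
Definition mink (x y : R41) : R :=
  \sum_(i < 4) (if i == ord_max then -1 else 1) * x 0 i * y 0 i.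

Definition e1 : R41 := delta_mx 0 (inord 0).
Definition e2 : R41 := delta_mx 0 (inord 1).
Definition e3 : R41 := delta_mx 0 (inord 2).
Definition e4 : R41 := delta_mx 0 (inord 3).

Definition span123 : {vspace R41} := <<[:: e1; e2; e3]>>%VS.
Definition span234 : {vspace R41} := <<[:: e2; e3; e4]>>%VS.

Definition open_interval (I : set R) : Prop :=
  [/\ open I, is_interval I & I !=set0].

Definition smooth_on (V : normedModType R) (I : set R) (h : R -> V) : Prop :=
  forall (k : nat) (x : R), I x -> derivable (derive1n k h) x 1.

Section SurfaceTheory.
Variable z : R -> R -> R41.

Definition du (w : R -> R -> R41) (u v : R) : R41 := derive1 (fun x => w x v) u.
Definition dv (w : R -> R -> R41) (u v : R) : R41 := derive1 (fun y => w u y) v.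

Definition ffE u v := mink (du z u v) (du z u v).
Definition ffF u v := mink (du z u v) (dv z u v).
Definition ffG u v := mink (dv z u v) (dv z u v).
Definition ffW u v := ffE u v * ffG u v - ffF u v ^+ 2.

(* Orthogonal projection onto the tangent plane, obtained by inverting the
   Gram matrix (E F; F G) of the coordinate fields. *)
Definition tangential (u v : R) (w : R41) : R41 :=
  ((ffG u v * mink w (du z u v) - ffF u v * mink w (dv z u v)) / ffW u v)
    *: du z u v +
  ((ffE u v * mink w (dv z u v) - ffF u v * mink w (du z u v)) / ffW u v)
    *: dv z u v.

Definition normal_part (u v : R) (w : R41) : R41 := w - tangential u v w.

(* The ambient connection is flat, so sigma(d_i, d_j) is the normal part of
   the second partial derivative z_ij. *)
Definition sigma_uu u v := normal_part u v (du (du z) u v).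
Definition sigma_uv u v := normal_part u v (dv (du z) u v).
Definition sigma_vv u v := normal_part u v (dv (dv z) u v).

(* H = (1/2) g^{ij} sigma_ij *)
Definition mean_curvature_vector (u v : R) : R41 :=
  (2 * ffW u v)^-1 *:
    (ffG u v *: sigma_uu u v - (2 * ffF u v) *: sigma_uv u v
     + ffE u v *: sigma_vv u v).

Definition HH (u v : R) : R :=
  mink (mean_curvature_vector u v) (mean_curvature_vector u v).

Definition epsH (u v : R) : R := Num.sg (HH u v).

Definition mean_curvature (u v : R) : R := Num.sqrt (epsH u v * HH u v).

End SurfaceTheory.

(* A unit-speed curve l in the unit quadric {V in W : <V,V> = 1} with a field n
   completing l, l' to an orthonormal frame of W, <n,n> = eps. *)
Record framed_curve (W : {vspace R41}) (eps : R) (J : set R) (l n : R -> R41)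
    : Prop := FramedCurve {
  fc_smooth_l : smooth_on J l;
  fc_smooth_n : smooth_on J n;
  fc_l : forall v, J v -> l v \in W /\ mink (l v) (l v) = 1;
  fc_t : forall v, J v -> derive1 l v \in W /\ mink (derive1 l v) (derive1 l v) = 1;
  fc_n : forall v, J v -> n v \in W /\ mink (n v) (n v) = eps;
  fc_lt : forall v, J v -> mink (l v) (derive1 l v) = 0;
  fc_ln : forall v, J v -> mink (l v) (n v) = 0;
  fc_tn : forall v, J v -> mink (derive1 l v) (n v) = 0
}.

Definition spherical_curvature (l n : R -> R41) (v : R) : R :=
  mink (derive1n 2 l v) (n v).

Definition meridian_curvature (f g : R -> R) (u : R) : R :=
  derive1 f u * derive1n 2 g u - derive1 g u * derive1n 2 f u.

Definition elliptic_surface (f g : R -> R) (l : R -> R41) (u v : R) : R41 :=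
  f u *: l v + g u *: e4.

Definition hyperbolic_surface (f g : R -> R) (l : R -> R41) (u v : R) : R41 :=
  f u *: l v + g u *: e1.

Record elliptic_data (I J : set R) (f g : R -> R) (l n : R -> R41) : Prop :=
  EllipticData {
  ell_I : open_interval I;
  ell_J : open_interval J;
  ell_smooth_f : smooth_on I f;
  ell_smooth_g : smooth_on I g;
  ell_f_gt0 : forall u, I u -> 0 < f u;
  ell_unit : forall u, I u -> derive1 f u ^+ 2 - derive1 g u ^+ 2 = 1;
  ell_dg : forall u, I u -> derive1 g u = Num.sqrt (derive1 f u ^+ 2 - 1);
  ell_curve : framed_curve span123 1 J l n
}.

Record hyperbolic_data (I J : set R) (f g : R -> R) (l n : R -> R41) : Prop :=
  HyperbolicData {
  hyp_I : open_interval I;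
  hyp_J : open_interval J;
  hyp_smooth_f : smooth_on I f;
  hyp_smooth_g : smooth_on I g;
  hyp_f_gt0 : forall u, I u -> 0 < f u;
  hyp_unit : forall u, I u -> derive1 f u ^+ 2 + derive1 g u ^+ 2 = 1;
  hyp_dg : forall u, I u -> derive1 g u = Num.sqrt (1 - derive1 f u ^+ 2);
  hyp_curve : framed_curve span234 (-1) J l n
}.

Definition general_class (I J : set R) (f g : R -> R) (l n : R -> R41) : Prop :=
  forall u v, I u -> J v ->
    meridian_curvature f g u * spherical_curvature l n v != 0.

(* [s] selects the upper ([false]) or lower ([true]) signs, in both places. *)
Definition cmc_bracket (a b C : R) (s : bool) (t : R) : R :=
  C + (-1) ^+ s * (t / 2 * Num.sqrt (b ^+ 2 - 4 * a ^+ 2 * t ^+ 2))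
    + (-1) ^+ s * (b ^+ 2 / (4 * a) * asin (2 * a * t / b)).

Definition y_elliptic (a b C : R) (s : bool) (t : R) : R :=
  Num.sqrt (1 + (t ^+ 2)^-1 * cmc_bracket a b C s t ^+ 2).

Definition y_hyperbolic (a b C : R) (s : bool) (t : R) : R :=
  Num.sqrt (1 - (t ^+ 2)^-1 * cmc_bracket a b C s t ^+ 2).

(* [Num.sqrt] and [asin] are total; these say that t lies in the domain where
   the formulas are meaningful.  The first condition also gives
   |2at/b| <= 1 when b != 0. *)
Definition y_elliptic_dom (a b t : R) : Prop :=
  0 <= b ^+ 2 - 4 * a ^+ 2 * t ^+ 2.

Definition y_hyperbolic_dom (a b C : R) (s : bool) (t : R) : Prop :=
  0 <= b ^+ 2 - 4 * a ^+ 2 * t ^+ 2 /\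
  0 <= 1 - (t ^+ 2)^-1 * cmc_bracket a b C s t ^+ 2.

End Minkowski.

(* Main.v *)
Require Import Defs.
From HB Require Import structures.
From mathcomp Require Import all_boot all_order all_algebra.
From mathcomp Require Import all_classical all_reals all_analysis.
From mathcomp Require Import ring lra.

Set Implicit Arguments.
Unset Strict Implicit.
Unset Printing Implicit Defensive.

Import Order.TTheory GRing.Theory Num.Theory.
Import numFieldNormedType.Exports.

Local Open Scope ring_scope.
Local Open Scope classical_set_scope.

(** Both parts are the same computation with a sign [eps]: [eps = 1] in the
    elliptic case, [eps = -1] in the hyperbolic one.  The surface is
    [z = f l + g e] with [e] a constant vector orthogonal to the 3-space of [l]
    and [<e,e> = - eps], while [<n,n> = eps] and [f'^2 - eps g'^2 = 1].

    Differentiating the orthonormality relations gives [l'' = - l + eps kappa n]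
    ([curve_acceleration]), and then, with [w = f kappa_m + g'],
    [4 f^2 <H,H> = eps (kappa^2 - w^2)] ([meridian_HH]).  So the requirement on
    [H] reads [<H,H> = eps a^2], that is
    [kappa(v)^2 = 4 a^2 f(u)^2 + w(u)^2].  The variables separate: [kappa^2] is
    constant, and [kappa], continuous without zeros, is a constant [b].  What
    remains is [w^2 = b^2 - 4 a^2 f^2].

    Belonging to the general class forces [f' > 0] and [g' > 0]: a zero of one
    of these nonnegative functions is a minimum, where the second derivative
    and hence [kappa_m] vanish.  So [f] is strictly increasing on an open
    interval, and [2 a f <= |b|] improves to [2 a f < |b|]: the square root and
    the arcsine are only used where they are differentiable, and [w] has no
    zero, hence a constant sign.

    Finally [f' kappa_m = g''] gives [(f g')' = f' w]: expressed through
    [t = f], the product [f g'] is a primitive of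
    [+- sqrt (b^2 - 4 a^2 t^2)], and so is the bracket in the formula for [y],
    hence [f g' = bracket] for some [C] ([profile_of_cmc]).  Since
    [f'^2 = 1 + eps g'^2], the equation [f' = y(f)] says exactly
    [(f g')^2 = bracket^2] ([profile_slope_iff]).  In the converse direction
    only [f g' = |bracket|] is known; the bracket does not vanish, so it equals
    [f g'] up to one global sign, which disappears in [w^2]
    ([cmc_of_profile]). *)

(** * Real functions on an open interval *)

Section OneVariable.
Context {R : realType}.
Implicit Types (I J : set R) (h : R -> R).

Lemma smooth_is_derive (V : normedModType R) I (h : R -> V) (k : nat) (x : R) :
  smooth_on I h -> I x -> is_derive x 1 (derive1n k h) (derive1n k.+1 h x).
Proof. by move=> hI Ix; rewrite derive1nS derive1E; apply/derivableP/hI. Qed.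

Lemma derive1_eq_on (V : normedModType R) I (h k : R -> V) (x : R) (d : V) :
  open I -> I x -> {in I, h =1 k} -> is_derive x 1 k d -> derive1 h x = d.
Proof.
move=> oI Ix hk dk; rewrite derive1E.
have nk : \forall y \near x, k y = h y.
  by near=> y; rewrite hk// inE; near: y; exact: open_nbhs_nbhs.
by have [_ ->] := near_eq_is_derive nk dk.
Unshelve. all: by end_near. Qed.

Lemma derive_cst_on (V : normedModType R) I (h : R -> V) (c : V) (x : R) (d : V) :
  open I -> I x -> (forall y, I y -> h y = c) -> is_derive x 1 h d -> d = 0.
Proof.
move=> oI Ix hc dh.
have : derive1 (cst c) x = d.
  by apply: (derive1_eq_on _ Ix) dh => // y /set_mem Iy /=; rewrite hc.
by rewrite derive1_cst.
Qed.

Lemma derive_continuous h (x d : R) : is_derive x 1 h d -> {for x, continuous h}.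
Proof. by move=> [dh _]; apply/differentiable_continuous/derivable1_diffP. Qed.

Lemma derive_within_itv I h (dh : R -> R) (x y : R) : is_interval I ->
  (forall u, I u -> is_derive u 1 h (dh u)) -> I x -> I y ->
  (forall u, u \in `]x, y[%R -> is_derive u 1 h (dh u))
  /\ {within `[x, y], continuous h}.
Proof.
move=> iI hI Ix Iy; have sub u : u \in `[x, y]%R -> I u.
  by rewrite in_itv/=; exact: iI.
split=> [u uxy|]; first exact/hI/sub/subset_itv_oo_cc.
by apply: derivable_within_continuous => u /sub /hI [].
Qed.

Lemma derive0_cst I h : is_interval I ->
  (forall u, I u -> is_derive u 1 h 0) -> forall x y, I x -> I y -> h x = h y.
Proof.
move=> iI hI; suff W x y : x <= y -> I x -> I y -> h x = h y.
  by move=> x y Ix Iy; case: (leP x y) => [|/ltW] xy; [|symmetry]; exact: W.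
move=> xy Ix Iy; have [D C] := derive_within_itv iI hI Ix Iy.
have [c _] := MVT_segment xy D C.
by rewrite mul0r => /eqP; rewrite subr_eq0 => /eqP.
Qed.

Lemma derive_gt0_lt I h (dh : R -> R) : is_interval I ->
  (forall u, I u -> is_derive u 1 h (dh u)) -> (forall u, I u -> 0 < dh u) ->
  forall x y, I x -> I y -> x < y -> h x < h y.
Proof.
move=> iI hI dh0 x y Ix Iy xy; have [D C] := derive_within_itv iI hI Ix Iy.
have [c /subset_itv_oo_cc] := MVT xy D C.
rewrite in_itv/= => cxy E; rewrite -subr_gt0 E mulr_gt0 ?subr_gt0//.
exact/dh0/(iI x y).
Qed.

Lemma open_itv_sub I x : open I -> I x ->
  exists2 e, 0 < e & forall y, x - e < y < x + e -> I y.
Proof.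
rewrite openE => oI /oI /nbhs_ballP[e /= e0 eI]; exists e => // y yx.
by apply: eI; rewrite /ball /= ltr_distl; lra.
Qed.

(** A zero of a nonnegative function is an interior minimum. *)
Lemma derive_zero_of_min I h (x d : R) : open I -> I x ->
  (forall u, I u -> derivable h u 1) -> (forall u, I u -> 0 <= h u) ->
  h x = 0 -> is_derive x 1 h d -> d = 0.
Proof.
move=> oI Ix dI h0 hx [_ <-]; have [e e0 eI] := open_itv_sub oI Ix.
have sub u : u \in `]x - e, x + e[%R -> I u by rewrite in_itv/=; exact: eI.
have : is_derive x 1 h 0.
  apply: (@derive1_at_min _ _ (x - e) (x + e)); [lra| | |].
  - by move=> u /sub; exact: dI.
  - by rewrite in_itv/=; lra.
  - by move=> u /sub Iu; rewrite hx h0.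
by case.
Qed.

(** A value [h u = m] would be exceeded slightly to the right of [u]. *)
Lemma increasing_lt_bound I h (m : R) : open I ->
  (forall x y, I x -> I y -> x < y -> h x < h y) ->
  (forall u, I u -> h u <= m) -> forall u, I u -> h u < m.
Proof.
move=> oI hI hm u Iu; have [e e0 eI] := open_itv_sub oI Iu.
have Iy : I (u + e / 2) by apply: eI; lra.
by apply: lt_le_trans (hm _ Iy); apply: hI => //; lra.
Qed.

(** By the intermediate value theorem; the sign is given as an exponent so that
    it can serve as the choice of [+-] in the bracket. *)
Lemma constant_sign I h : is_interval I ->
  (forall u, I u -> {for u, continuous h}) -> (forall u, I u -> h u != 0) ->
  exists s : bool, forall u, I u -> 0 < (-1) ^+ s * h u.
Proof.
move=> iI cI h0.
have same x y : I x -> I y -> x <= y -> 0 < h x * h y.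
  move=> Ix Iy xy; rewrite ltNge; apply/negP => hxy.
  have sub u : u \in `[x, y]%R -> I u by rewrite in_itv/=; exact: iI.
  have C : {within `[x, y], continuous h}.
    by apply: continuous_in_subspaceT => u /set_mem /sub; exact: cI.
  have [|c /sub Ic hc] := IVT (v := 0) xy C; last by move: (h0 c Ic); rewrite hc eqxx.
  rewrite ge_min le_max; case: (ltrgtP (h x) 0) => [hx|hx|hx].
  - by move: hxy; rewrite nmulr_rle0 // => ->.
  - by move: hxy; rewrite pmulr_rle0 // => ->; rewrite orbT.
  - by [].
have [[x0 Ix0]|nI] := pselect (I !=set0); last by exists false => u Iu; case: nI; exists u.
exists (h x0 < 0) => u Iu.
have : 0 < h x0 * h u.
  by case: (leP x0 u) => [|/ltW] xu; last rewrite mulrC; exact: same.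
case: (ltrgtP (h x0) 0) (h0 _ Ix0) => [hx|hx|//] _; rewrite ?expr1 ?mul1r.
  by rewrite nmulr_rgt0// mulN1r oppr_gt0.
by rewrite pmulr_rgt0.
Qed.

Lemma eq_signed (s : bool) (x w : R) : 0 < (-1) ^+ s * x -> 0 <= w ->
  x ^+ 2 = w ^+ 2 -> x = (-1) ^+ s * w.
Proof.
move=> sx w0 xw; have E : (-1) ^+ s * x = w.
  apply/eqP; rewrite -(eqrXn2 (n := 2)) ?(ltW sx)//.
  by rewrite exprMn sqrr_sign mul1r xw.
by rewrite -E signrMK.
Qed.

End OneVariable.

(** * Minkowski geometry of meridian surfaces *)

Section Geometry.
Context {R : realType}.
Local Notation R41 := 'rV[R]_4.

Lemma minkC (x y : R41) : mink x y = mink y x.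
Proof. by apply: eq_bigr => i _; rewrite -!mulrA [x 0 i * _]mulrC. Qed.

Lemma minkDl (x y w : R41) : mink (x + y) w = mink x w + mink y w.
Proof.
by rewrite -big_split; apply: eq_bigr => i _ /=; rewrite mxE mulrDr mulrDl.
Qed.

Lemma minkZl (k : R) (x w : R41) : mink (k *: x) w = k * mink x w.
Proof. by rewrite mulr_sumr; apply: eq_bigr => i _; rewrite mxE; ring. Qed.

Lemma minkDr (x y w : R41) : mink w (x + y) = mink w x + mink w y.
Proof. by rewrite minkC minkDl !(minkC w). Qed.

Lemma minkZr (k : R) (x w : R41) : mink w (k *: x) = k * mink w x.
Proof. by rewrite minkC minkZl (minkC w). Qed.

Lemma mink0r (w : R41) : mink w 0 = 0.
Proof. by rewrite -(scale0r (0 : R41)) minkZr mul0r. Qed.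

Lemma is_derive_mink (X Y : R -> R41) (v : R) (dX dY : R41) :
  is_derive v 1 X dX -> is_derive v 1 Y dY ->
  is_derive v 1 (fun s => mink (X s) (Y s)) (mink dX (Y v) + mink (X v) dY).
Proof.
move=> [DX <-] [DY <-].
have coord (Z : R -> R41) i : derivable Z v 1 ->
    is_derive v 1 (fun s => Z s 0 i) ('D_1 Z v 0 i).
  move=> DZ; split; first by have /derivable_mxP := DZ; exact.
  by rewrite derive_mx// mxE.
rewrite /mink -big_split/=.
have -> : (fun s => \sum_(i < 4) (if i == ord_max then -1 else 1) * X s 0 i * Y s 0 i)
   = \sum_(i < 4) (cst (if i == ord_max then -1 else 1) * (fun s => X s 0 i)
       * (fun s => Y s 0 i)).
  by apply/funext => s; rewrite fct_sumE.
apply: is_derive_sum => i.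
have := coord _ i DX; have := coord _ i DY => dy dx.
apply: is_derive_eq.
have scE (k z : R) : k *: (z : R^o) = k * z by [].
rewrite !scE mulrfctE /=; ring.
Qed.

Lemma is_derive_scaleL (h : R -> R) (w : R41) (u d : R) :
  is_derive u 1 h d -> is_derive u 1 (fun s => h s *: w) (d *: w).
Proof.
move=> [dh <-]; move/derivable1_diffP: (dh) => D.
have DZ := differentiableZl w D.
split; first exact: diff_derivable.
by rewrite deriveE// diffZl//= deriveE.
Qed.

(** With [M] the matrix of frame vectors and [N] the matrix of the metric,
    orthonormality reads [M N M^T = Q] with [Q] an involution, so [N M^T Q] is a
    right inverse of [M], hence also a left inverse. *)
Lemma orthonormal_expansion (q : 'I_4 -> R) (F : 'I_4 -> R41) (x : R41) :
  (forall i, q i * q i = 1) ->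
  (forall i j, mink (F i) (F j) = q i *+ (i == j)) ->
  x = \sum_i (q i * mink x (F i)) *: F i.
Proof.
move=> qq FF.
pose N : 'M[R]_4 := diag_mx (\row_i (if i == ord_max then -1 else 1)).
pose M : 'M[R]_4 := \matrix_i F i.
pose Q : 'M[R]_4 := diag_mx (\row_i q i).
have minkE (y : R41) i : (y *m N *m M^T) 0 i = mink y (F i).
  rewrite mxE; apply: eq_bigr => j _.
  by rewrite mul_mx_diag !mxE mulrC [y _ _ * _]mulrC mulrC.
have MNM : M *m N *m M^T = Q.
  apply/matrixP => i j; rewrite mxE [RHS]mxE [in RHS]mxE -FF.
  apply: eq_bigr => k _; rewrite mul_mx_diag !mxE.
  by rewrite [F i _ _ * _]mulrC.
have QQ : Q *m Q = 1%:M.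
  apply/matrixP => i j; rewrite mul_diag_mx !mxE.
  by case: eqP => [->|_]; rewrite ?mulr1n ?mulr0n ?mulr0 ?qq.
have : M *m (N *m M^T *m Q) = 1%:M by rewrite !mulmxA MNM.
move/mulmx1C => inv; rewrite -[x in LHS]mulmx1 -inv !mulmxA.
apply/rowP => k; rewrite mxE summxE; apply: eq_bigr => i _.
by rewrite mul_mx_diag mxE minkE !mxE [q i * _]mulrC.
Qed.

Lemma span_orthogonal (X : seq R41) (e w : R41) :
  (forall x, x \in X -> mink x e = 0) -> w \in <<X>>%VS -> mink w e = 0.
Proof.
move=> Xe /(coord_span (X := in_tuple X)) ->.
elim/big_ind: _ => // [|x y xe ye|i _]; first by rewrite minkC mink0r.
   by rewrite minkDl xe ye addr0.
by rewrite minkZl Xe ?mulr0// mem_nth.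
Qed.

(** The four scalar products of [l''] with the orthonormal frame [l, l', n, e]
    come from differentiating [<l,l'> = 0], [<l',l'> = 1] and [<l',e> = 0], and
    from the definition of the spherical curvature. *)
Lemma curve_acceleration (W : {vspace R41}) (eps : R) (e : R41) (J : set R)
    (l n : R -> R41) (v : R) :
  eps * eps = 1 -> (forall w, w \in W -> mink w e = 0) -> mink e e = - eps ->
  open J -> framed_curve W eps J l n -> J v ->
  derive1n 2 l v = - l v + (eps * spherical_curvature l n v) *: n v.
Proof.
move=> epsK We ee oJ [sl sn hl ht hn lt ln tn] Jv.
have dl w : J w -> is_derive w 1 l (derive1 l w).
  by move=> Jw; exact: (smooth_is_derive 0 sl Jw).
have dt w : J w -> is_derive w 1 (derive1 l) (derive1n 2 l w).
  by move=> Jw; exact: (smooth_is_derive 1 sl Jw).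
set a := derive1n 2 l v.
have al : mink a (l v) = -1.
  have := derive_cst_on oJ Jv lt (is_derive_mink (dl v Jv) (dt v Jv)).
  rewrite (ht v Jv).2 minkC => /eqP; rewrite addrC addr_eq0 => /eqP.
  by rewrite minkC.
have at_ : mink a (derive1 l v) = 0.
  have := derive_cst_on oJ Jv (fun w Jw => (ht w Jw).2)
    (is_derive_mink (dt v Jv) (dt v Jv)).
  rewrite [X in _ + X]minkC -/a; lra.
have ae : mink a e = 0.
  have := derive_cst_on oJ Jv (fun w Jw => We _ (ht w Jw).1)
    (is_derive_mink (dt v Jv) (is_derive_cst e v 1)).
  by rewrite mink0r addr0.
pose q (i : 'I_4) : R := nth 0 [:: 1; 1; eps; - eps] i.
pose F (i : 'I_4) : R41 := nth 0 [:: l v; derive1 l v; n v; e] i.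
have qq i : q i * q i = 1.
  by case: i => [[|[|[|[|//]]]]] hi; rewrite /q /= ?mulrNN ?mulr1.
have FF i j : mink (F i) (F j) = q i *+ (i == j).
  have [hl1 hl2] := hl v Jv; have [ht1 ht2] := ht v Jv; have [hn1 hn2] := hn v Jv.
  case: i => [[|[|[|[|//]]]]] hi; case: j => [[|[|[|[|//]]]]] hj;
  rewrite /F /q -val_eqE /= ?mulr1n ?mulr0n //;
  by [rewrite ?lt ?ln ?tn ?We | rewrite minkC ?lt ?ln ?tn ?We].
rewrite {1}(orthonormal_expansion a qq FF) !big_ord_recr big_ord0 /= add0r /q /F /=.
by rewrite al at_ ae !mulr0 !scale0r !addr0 mul1r scaleN1r.
Qed.

Lemma derive_quadric (eps : R) (I : set R) (p q : R -> R) (u dp dq : R) :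
  open I -> (forall u, I u -> p u ^+ 2 - eps * q u ^+ 2 = 1) -> I u ->
  is_derive u 1 p dp -> is_derive u 1 q dq -> p u * dp = eps * (q u * dq).
Proof.
move=> oI unit Iu hp hq.
have := derive_cst_on oI Iu unit
  (is_deriveB (is_deriveX 2 hp) (is_deriveZ eps (is_deriveX 2 hq))).
rewrite /GRing.scale /= !expr1; lra.
Qed.

(** The algebra behind the formula for [<H,H>], with [p, q, p2, q2] the first and
    second derivatives of [f] and [g], [F] the value of [f] and [k] the
    spherical curvature: the left side is the squared length of [2 f^2 H]. *)
Lemma mean_curvature_identity (eps p q p2 q2 F k : R) :
  eps * eps = 1 -> p ^+ 2 - eps * q ^+ 2 = 1 -> p * p2 = eps * (q * q2) ->
  (F ^+ 2 * p2 + (F * p ^+ 2 - F)) ^+ 2 + eps * (eps * F * k) ^+ 2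
    - eps * (F ^+ 2 * q2 + F * p * q) ^+ 2
  = eps * F ^+ 2 * (k ^+ 2 - (F * (p * q2 - q * p2) + q) ^+ 2).
Proof.
move=> /eqP; rewrite -subr_eq0 => /eqP K.
move=> /eqP; rewrite -subr_eq0 => /eqP U.
move=> /eqP; rewrite -subr_eq0 => /eqP D.
apply/eqP; rewrite -subr_eq0; apply/eqP.
(* The difference of the two sides, written in the ideal generated by the
   three hypotheses. *)
transitivity (F ^+ 2 * (F ^+ 2 * ((p ^+ 2 - eps * q ^+ 2 - 1) * (eps * q2 ^+ 2 - p2 ^+ 2)
    + (p * p2 - eps * (q * q2)) ^+ 2)
  + (p ^+ 2 - eps * q ^+ 2 - 1) * (2 * F * p2 + eps * q ^+ 2
    + (p ^+ 2 - eps * q ^+ 2 - 1)))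
  + eps * F ^+ 2 * k ^+ 2 * (eps * eps - 1)); first by ring.
by rewrite K U D; ring.
Qed.

(** The coordinate fields [f' l + g' e] and [f l'] are orthogonal of squared
    lengths [1] and [f^2], so [2 f^2 H = f^2 sigma_uu + sigma_vv].  The vector
    [z_uu] is already normal because [u] is an arc length parameter, while
    [z_vv = f l''] loses its component along [z_u] only. *)
Lemma HH_of_derivatives (eps : R) (l t n e : R41) (z : R -> R -> R41)
    (u v p q p2 q2 F k : R) :
  eps * eps = 1 -> mink l l = 1 -> mink t t = 1 -> mink n n = eps ->
  mink e e = - eps -> mink l t = 0 -> mink l n = 0 -> mink t n = 0 ->
  mink l e = 0 -> mink t e = 0 -> mink n e = 0 ->
  p ^+ 2 - eps * q ^+ 2 = 1 -> p * p2 = eps * (q * q2) -> 0 < F ->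
  du z u v = p *: l + q *: e -> dv z u v = F *: t ->
  du (du z) u v = p2 *: l + q2 *: e ->
  dv (dv z) u v = F *: (- l + (eps * k) *: n) ->
  4 * F ^+ 2 * HH z u v =
  eps * (k ^+ 2 - (F * (p * q2 - q * p2) + q) ^+ 2).
Proof.
move=> epsK ll tt nn ee lt ln tn le te ne un dun F_gt0 zu zv zuu zvv.
have [tl nl nt] : [/\ mink t l = 0, mink n l = 0 & mink n t = 0].
  by split; rewrite minkC.
have [el et en] : [/\ mink e l = 0, mink e t = 0 & mink e n = 0].
  by split; rewrite minkC.
pose mE := (minkDl, minkDr, minkZl, minkZr, ll, tt, nn, lt, ln, tn, tl, nl, nt,
            le, te, ne, el, et, en, ee).
have F_neq0 : F != 0 by rewrite gt_eqF.
have E1 : ffE z u v = 1 by rewrite /ffE zu !mE -[RHS]un; ring.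
have F0 : ffF z u v = 0 by rewrite /ffF zu zv !mE; ring.
have Gf : ffG z u v = F ^+ 2 by rewrite /ffG zv !mE; ring.
have Wf : ffW z u v = F ^+ 2 by rewrite /ffW E1 F0 Gf; ring.
have tanE w : tangential z u v w =
    mink w (du z u v) *: du z u v + (mink w (dv z u v) / F ^+ 2) *: dv z u v.
  rewrite /tangential E1 F0 Gf Wf.
  move: (mink w (du z u v)) (mink w (dv z u v)) (du z u v) (dv z u v) => A B X Y.
  rewrite !mul0r !subr0 mul1r.
  by rewrite [F ^+ 2 * _]mulrC mulfK// expf_neq0.
have Suu : sigma_uu z u v = p2 *: l + q2 *: e.
  rewrite /sigma_uu /normal_part tanE zuu zu zv.
  have -> : mink (p2 *: l + q2 *: e) (p *: l + q *: e) = 0.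
    by rewrite !mE -[RHS](subrr (p * p2)) {2}dun; ring.
  by rewrite !mE !(mulr0, mul0r, scale0r, addr0, subr0).
have Svv : sigma_vv z u v =
    (F * p ^+ 2 - F) *: l + (eps * F * k) *: n + (F * p * q) *: e.
  rewrite /sigma_vv /normal_part tanE zvv zu zv -[- l]scaleN1r !mE.
  rewrite !(mulr0, mul0r, mulr1, scale0r, addr0, subr0).
  by apply/rowP => i; rewrite !mxE; ring.
rewrite /HH /mean_curvature_vector Suu Svv E1 F0 Gf Wf mulr0 scale0r subr0 scale1r.
set V := (X in mink (_ *: X) _); rewrite minkZl minkZr.
have -> : mink V V = eps * F ^+ 2 * (k ^+ 2 - (F * (p * q2 - q * p2) + q) ^+ 2).
  by rewrite /V !mE -(mean_curvature_identity _ _ epsK un dun); ring.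
by field.
Qed.

Lemma meridian_HH (W : {vspace R41}) (eps : R) (e : R41) (I J : set R)
    (f g : R -> R) (l n : R -> R41) (u v : R) :
  eps * eps = 1 -> (forall w, w \in W -> mink w e = 0) -> mink e e = - eps ->
  open I -> open J -> smooth_on I f -> smooth_on I g ->
  (forall u, I u -> 0 < f u) ->
  (forall u, I u -> derive1 f u ^+ 2 - eps * derive1 g u ^+ 2 = 1) ->
  framed_curve W eps J l n -> I u -> J v ->
  4 * f u ^+ 2 * HH (fun u v => f u *: l v + g u *: e) u v =
  eps * (spherical_curvature l n v ^+ 2
         - (f u * meridian_curvature f g u + derive1 g u) ^+ 2).
Proof.
move=> epsK We ee oI oJ sf sg f0 unit cur Iu Jv.
have acc := curve_acceleration epsK We ee oJ cur Jv.
case: cur => sl sn hl ht hn lt ln tn.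
have df w : I w -> is_derive w 1 f (derive1 f w).
  by move=> Iw; exact: (smooth_is_derive 0 sf Iw).
have ddf w : I w -> is_derive w 1 (derive1 f) (derive1n 2 f w).
  by move=> Iw; exact: (smooth_is_derive 1 sf Iw).
have dg w : I w -> is_derive w 1 g (derive1 g w).
  by move=> Iw; exact: (smooth_is_derive 0 sg Iw).
have ddg w : I w -> is_derive w 1 (derive1 g) (derive1n 2 g w).
  by move=> Iw; exact: (smooth_is_derive 1 sg Iw).
have dl w : J w -> is_derive w 1 l (derive1 l w).
  by move=> Jw; exact: (smooth_is_derive 0 sl Jw).
have ddl w : J w -> is_derive w 1 (derive1 l) (derive1n 2 l w).
  by move=> Jw; exact: (smooth_is_derive 1 sl Jw).
set z := (fun u v => _).
have zu w y : I w -> du z w y = derive1 f w *: l y + derive1 g w *: e.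
  move=> Iw; rewrite /du derive1E /z.
  by have [_ ->] := is_deriveD (is_derive_scaleL (l y) (df w Iw))
                               (is_derive_scaleL e (dg w Iw)).
have zv w y : J y -> dv z w y = f w *: derive1 l y.
  move=> Jy; rewrite /dv derive1E /z.
  have [_ ->] := is_deriveD (is_deriveZ (f w) (dl y Jy))
                               (is_derive_cst (g w *: e) y 1).
  by rewrite addr0.
have zuu : du (du z) u v = derive1n 2 f u *: l v + derive1n 2 g u *: e.
  rewrite {1}/du; apply: (derive1_eq_on oI Iu); last first.
    exact: is_deriveD (is_derive_scaleL (l v) (ddf u Iu))
                               (is_derive_scaleL e (ddg u Iu)).
  by move=> w /set_mem Iw; rewrite zu.
have zvv : dv (dv z) u v = f u *: derive1n 2 l v.
  rewrite {1}/dv; apply: (derive1_eq_on oJ Jv); last first.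
    exact: (is_deriveZ (f u) (ddl v Jv)).
  by move=> w /set_mem Jw; rewrite zv.
have [hl1 hl2] := hl v Jv; have [ht1 ht2] := ht v Jv; have [hn1 hn2] := hn v Jv.
apply: HH_of_derivatives (zu _ _ Iu) (zv _ _ Jv) zuu _; rewrite ?zvv ?acc//;
  by [exact: hn2 | exact: lt | exact: ln | exact: tn | exact: We | exact: unit | exact: f0
     | exact: derive_quadric oI unit Iu (ddf u Iu) (ddg u Iu)].
Qed.

End Geometry.

(** * The differential equation of the profile *)

Section Profile.
Context {R : realType}.

Lemma is_derive_cmc_bracket (a b C : R) (s : bool) (t : R) :
  0 < a -> 0 < b -> 0 < t -> 2 * a * t < b ->
  is_derive t 1 (cmc_bracket a b C s)
    ((-1) ^+ s * Num.sqrt (b ^+ 2 - 4 * a ^+ 2 * t ^+ 2)).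
Proof.
move=> a0 b0 t0 atb.
set r := b ^+ 2 - 4 * a ^+ 2 * t ^+ 2.
have r0 : 0 < r.
  have -> : r = (b - 2 * a * t) * (b + 2 * a * t) by rewrite /r; ring.
  by rewrite mulr_gt0 ?subr_gt0 ?addr_gt0 ?mulr_gt0.
have S0 : Num.sqrt r != 0 by rewrite gt_eqF ?sqrtr_gt0.
have dq : is_derive t 1 (fun t => b ^+ 2 - 4 * a ^+ 2 * t ^+ 2) (- (8 * a ^+ 2 * t)).
  have := is_deriveB (is_derive_cst (b ^+ 2) t 1)
    (is_deriveZ (4 * a ^+ 2) (is_deriveX 2 (is_derive_id t (1 : R)))).
  by move/is_derive_eq; apply; rewrite /GRing.scale /= expr1; ring.
have dS := is_derive1_comp
  (g := fun t => b ^+ 2 - 4 * a ^+ 2 * t ^+ 2) (is_derive1_sqrt r0) dq.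
have dlin : is_derive t 1 (fun t => 2 * a * t / b) (2 * a / b).
  have := is_deriveM (is_deriveZ (2 * a) (is_derive_id t (1 : R))) (is_derive_cst b^-1 t 1).
  by move/is_derive_eq; apply; rewrite /GRing.scale /=; ring.
have at1 : -1 < 2 * a * t / b < 1.
  by rewrite ltr_pdivlMr// mulN1r ltr_pdivrMr// mul1r atb andbT (lt_trans (y := 0))
             ?oppr_lt0 ?mulr_gt0.
have dA := is_derive1_comp (g := fun t => 2 * a * t / b)
  (is_derive1_asin at1) dlin.
have sqE : Num.sqrt (1 - (2 * a * t / b) ^+ 2) = Num.sqrt r / b.
  have -> : 1 - (2 * a * t / b) ^+ 2 = r * (b^-1) ^+ 2 by rewrite /r; field; rewrite gt_eqF.
  by rewrite sqrtrM ?ltW// sqrtr_sqr gtr0_norm ?invr_gt0.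
have dt2 : is_derive t 1 (fun t => t / 2) (2^-1 : R).
  have := is_deriveM (is_derive_id t (1 : R)) (is_derive_cst (2^-1 : R) t 1).
  by move/is_derive_eq; apply; rewrite /GRing.scale /=; ring.
have := is_deriveD (is_deriveD (is_derive_cst C t 1)
  (is_deriveZ ((-1) ^+ s) (is_deriveM dt2 dS)))
  (is_deriveZ ((-1) ^+ s) (is_deriveZ (b ^+ 2 / (4 * a)) dA)).
move/is_derive_eq; apply; rewrite sqE /GRing.scale /= add0r -!mulrDr; congr (_ * _).
have SS : Num.sqrt r * Num.sqrt r = r by rewrite -expr2 sqr_sqrtr ?ltW.
rewrite -/r.
(* [1/2 S - 2 a^2 t^2 / S + b^2 / (2 S)] with [S ^ 2 = r]. *)
transitivity (Num.sqrt r / 2 + r / (2 * Num.sqrt r)).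
  by rewrite /r; field; rewrite ?S0 ?gt_eqF.
by rewrite -{2}SS; field.
Qed.

(** Here [df], [q], [dq], [km] stand for [f'], [g'], [g''] and [kappa_m].  In
    terms of these the two types of meridian obey the same equation. *)
Section Ode.
Variables (I : set R) (f df q dq km : R -> R) (a : R).
Hypotheses (a_gt0 : 0 < a) (oI : open I) (iI : is_interval I).
Hypotheses (dfE : forall u, I u -> is_derive u 1 f (df u))
  (dqE : forall u, I u -> is_derive u 1 q (dq u)).
Hypotheses (f_gt0 : forall u, I u -> 0 < f u) (df_gt0 : forall u, I u -> 0 < df u)
  (q_gt0 : forall u, I u -> 0 < q u)
  (kmE : forall u, I u -> df u * km u = dq u).

Lemma is_derive_moment u : I u ->
  is_derive u 1 (fun u => f u * q u) (df u * (f u * km u + q u)).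
Proof.
move=> Iu; have := is_deriveM (dfE Iu) (dqE Iu).
by move/is_derive_eq; apply; rewrite /GRing.scale /= -kmE//; ring.
Qed.

(** The formula for [y] makes sense for [2 a t <= b], but is differentiable only
    for [2 a t < b]; monotonicity of [f] on an open interval closes the gap. *)
Lemma profile_strict b : 0 < b ->
  (forall u, I u -> 0 <= b ^+ 2 - 4 * a ^+ 2 * f u ^+ 2) ->
  forall u, I u -> 2 * a * f u < b.
Proof.
move=> b0 dom u Iu.
rewrite mulrC -ltr_pdivlMr ?mulr_gt0//.
apply: (increasing_lt_bound oI _ _ Iu) => [x y|w Iw].
  exact: (derive_gt0_lt iI dfE df_gt0).
have fa0 : 0 <= f w * (2 * a) by rewrite !mulr_ge0 ?ltW ?f_gt0.
rewrite ler_pdivlMr ?mulr_gt0// -ler_sqr ?nnegrE ?(ltW b0)//.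
by rewrite -subr_ge0; have := dom w Iw; congr (_ <= _); ring.
Qed.

Lemma is_derive_bracket_profile b C s u : 0 < b ->
  (forall u, I u -> 0 <= b ^+ 2 - 4 * a ^+ 2 * f u ^+ 2) -> I u ->
  is_derive u 1 (fun u => cmc_bracket a b C s (f u))
    ((-1) ^+ s * Num.sqrt (b ^+ 2 - 4 * a ^+ 2 * f u ^+ 2) * df u).
Proof.
move=> b0 dom Iu; apply: (is_derive1_comp _ (dfE Iu)).
by apply: is_derive_cmc_bracket; rewrite ?f_gt0//; exact: profile_strict Iu.
Qed.

(** [f kappa_m + g'] is [+- sqrt (b^2 - 4 a^2 f^2)] with one sign on all of [I], as
    it has no zero; so [f q] and the bracket have equal derivatives. *)
Lemma profile_of_cmc (b : R) : 0 < b -> I !=set0 ->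
  (forall u, I u -> {for u, continuous (fun u => f u * km u + q u)}) ->
  (forall u, I u ->
     b ^+ 2 = 4 * a ^+ 2 * f u ^+ 2 + (f u * km u + q u) ^+ 2) ->
  exists C s, forall u, I u -> 0 <= b ^+ 2 - 4 * a ^+ 2 * f u ^+ 2 /\
    f u * q u = cmc_bracket a b C s (f u).
Proof.
move=> b0 [u0 Iu0] cw cmc.
have wE u : I u -> (f u * km u + q u) ^+ 2 = b ^+ 2 - 4 * a ^+ 2 * f u ^+ 2.
  by move=> /cmc ->; ring.
have dom u : I u -> 0 <= b ^+ 2 - 4 * a ^+ 2 * f u ^+ 2.
  by move=> /wE <-; exact: sqr_ge0.
have w0 u : I u -> f u * km u + q u != 0.
  move=> Iu; rewrite -sqrf_eq0 wE// gt_eqF//.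
  have fa0 : 0 <= 2 * a * f u by rewrite !mulr_ge0 ?ltW ?f_gt0.
  have := profile_strict b0 dom Iu.
  rewrite -ltr_sqr ?nnegrE ?(ltW b0)//.
  by rewrite -subr_gt0; congr (_ < _); ring.
have [s ws] := constant_sign iI cw w0.
(* The constant of integration, read off at [u0]. *)
exists (f u0 * q u0 - cmc_bracket a b 0 s (f u0)), s => u Iu; split; first exact: dom.
have D w : I w -> is_derive w 1 (fun u => f u * q u - cmc_bracket a b 0 s (f u)) 0.
  move=> Iw; have := is_deriveB (is_derive_moment Iw)
    (is_derive_bracket_profile 0 s b0 dom Iw).
  move/is_derive_eq; apply.
  have -> : f w * km w + q w =
      (-1) ^+ s * Num.sqrt (b ^+ 2 - 4 * a ^+ 2 * f w ^+ 2).
    by apply: eq_signed (ws w Iw) (sqrtr_ge0 _) _; rewrite sqr_sqrtr ?dom// wE.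
  by ring.
rewrite (derive0_cst iI D Iu0 Iu) /cmc_bracket; ring.
Qed.

(** The bracket has no zero along [f], because [f q > 0]; so it is [f q] up to one
    sign, and differentiating gives [f kappa_m + g'] up to sign. *)
Lemma cmc_of_profile (b C : R) (s : bool) : 0 < b ->
  (forall u, I u -> 0 <= b ^+ 2 - 4 * a ^+ 2 * f u ^+ 2 /\
    (f u * q u) ^+ 2 = cmc_bracket a b C s (f u) ^+ 2) ->
  forall u, I u -> b ^+ 2 = 4 * a ^+ 2 * f u ^+ 2 + (f u * km u + q u) ^+ 2.
Proof.
move=> b0 H; have dom u : I u -> 0 <= b ^+ 2 - 4 * a ^+ 2 * f u ^+ 2.
  by move=> /H[].
have dB u (Iu : I u) := is_derive_bracket_profile C s b0 dom Iu.
have [||s' Bs] := constant_sign (h := fun u => cmc_bracket a b C s (f u)) iI.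
- by move=> u Iu; exact: derive_continuous (dB u Iu).
- move=> u Iu; rewrite -sqrf_eq0 -(H u Iu).2 sqrf_eq0.
  by rewrite mulf_neq0 ?gt_eqF ?f_gt0 ?q_gt0.
move=> u Iu.
have BE w : I w -> f w * q w - (-1) ^+ s' * cmc_bracket a b C s (f w) = 0.
  move=> Iw; have fq0 : 0 <= f w * q w by rewrite ltW// mulr_gt0 ?f_gt0 ?q_gt0.
  by rewrite (eq_signed (Bs w Iw) fq0 (esym (H w Iw).2)) signrMK subrr.
have := derive_cst_on oI Iu BE
  (is_deriveB (is_derive_moment Iu) (is_deriveZ ((-1) ^+ s') (dB u Iu))).
rewrite /GRing.scale /= => /eqP.
rewrite [X in _ - X](_ : _ = df u * ((-1) ^+ s' * ((-1) ^+ s *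
  Num.sqrt (b ^+ 2 - 4 * a ^+ 2 * f u ^+ 2)))); last by ring.
rewrite -mulrBr mulf_eq0 gt_eqF ?df_gt0//= subr_eq0 => /eqP ->.
rewrite !exprMn !sqrr_sign !mul1r sqr_sqrtr ?dom//; ring.
Qed.

End Ode.

End Profile.

(** * Constant mean curvature *)

Section Meridian.
Context {R : realType}.

Lemma signed_sqrt_eq (eps a h : R) : eps * eps = 1 -> 0 < a ->
  (Num.sg h = eps /\ Num.sqrt (Num.sg h * h) = a) <-> h = eps * a ^+ 2.
Proof.
move=> epsK a0; split=> [[<- <-]|->].
  by rewrite sqr_sqrtr -normrEsg// -numEsg.
have sge : Num.sg eps = eps.
  apply/eqP; move/eqP: epsK; rewrite -expr2 sqrf_eq1 => /orP[]/eqP->.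
    by rewrite sgr1.
  by rewrite sgrN1.
have -> : Num.sg (eps * a ^+ 2) = eps by rewrite sgrM sge gtr0_sg ?mulr1// exprn_gt0.
by split=> //; rewrite mulrA epsK mul1r sqrtr_sqr gtr0_norm.
Qed.

Lemma spherical_curvature_continuous (W : {vspace 'rV[R]_4}) (eps : R) (J : set R)
    (l n : R -> 'rV[R]_4) (v : R) :
  framed_curve W eps J l n -> J v -> {for v, continuous (spherical_curvature l n)}.
Proof.
move=> [sl sn _ _ _ _ _ _] Jv; apply: derive_continuous.
exact: is_derive_mink (smooth_is_derive 2 sl Jv) (smooth_is_derive 0 sn Jv).
Qed.

Section MeridianCurve.
Variables (eps : R) (I : set R) (f g : R -> R).
Hypotheses (epsK : eps * eps = 1) (oI : open I) (sf : smooth_on I f)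
  (sg : smooth_on I g).
Hypotheses (f_gt0 : forall u, I u -> 0 < f u)
  (df_ge0 : forall u, I u -> 0 <= derive1 f u)
  (dg_ge0 : forall u, I u -> 0 <= derive1 g u)
  (unit : forall u, I u -> derive1 f u ^+ 2 - eps * derive1 g u ^+ 2 = 1)
  (km0 : forall u, I u -> meridian_curvature f g u != 0).

(** Where [f'] or [g'] vanishes it is minimal, so its derivative vanishes too, and
    both terms of the meridian curvature are zero. *)
Lemma meridian_derivs_gt0 u : I u -> 0 < derive1 f u /\ 0 < derive1 g u.
Proof.
move=> Iu; have := km0 Iu; rewrite !lt0r df_ge0// dg_ge0// !andbT.
rewrite /meridian_curvature => km; split; apply: contraNneq km => h0.
  rewrite (derive_zero_of_min oI Iu (@sf 1%N) df_ge0 h0 (smooth_is_derive 1 sf Iu)).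
  by rewrite h0 mul0r mulr0 subrr.
rewrite (derive_zero_of_min oI Iu (@sg 1%N) dg_ge0 h0 (smooth_is_derive 1 sg Iu)).
by rewrite h0 mul0r mulr0 subrr.
Qed.

Lemma derive_mul_meridian_curvature u : I u ->
  derive1 f u * meridian_curvature f g u = derive1n 2 g u.
Proof.
move=> Iu; have D := derive_quadric oI unit Iu
  (smooth_is_derive 1 sf Iu) (smooth_is_derive 1 sg Iu).
rewrite /meridian_curvature.
transitivity (derive1 f u ^+ 2 * derive1n 2 g u
  - derive1 g u * (derive1 f u * derive1n 2 f u)); first by ring.
rewrite D -[RHS]mul1r -(unit Iu); ring.
Qed.

Lemma meridian_expression_continuous u : I u ->
  {for u, continuous (fun u => f u * meridian_curvature f g u + derive1 g u)}.
Proof.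
move=> Iu; pose D k := smooth_is_derive k sf Iu; pose E k := smooth_is_derive k sg Iu.
exact: (derive_continuous (is_deriveD (is_deriveM (D 0)
  (is_deriveB (is_deriveM (D 1) (E 2)) (is_deriveM (E 1) (D 2)))) (E 1))).
Qed.

(** Eliminating [f'] by [f'^2 = 1 + eps g'^2] turns [f' = y(f)] into a relation
    for [f g'] in which [eps] no longer appears. *)
Lemma profile_slope_iff (B : R) u : I u ->
  (0 <= 1 + eps * ((f u ^+ 2)^-1 * B ^+ 2) /\
   derive1 f u = Num.sqrt (1 + eps * ((f u ^+ 2)^-1 * B ^+ 2)))
  <-> (f u * derive1 g u) ^+ 2 = B ^+ 2.
Proof.
move=> Iu; have fu0 : f u != 0 by rewrite gt_eqF ?f_gt0.
have un := unit Iu.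
have key : eps * ((f u ^+ 2)^-1 * (f u * derive1 g u) ^+ 2) = eps * derive1 g u ^+ 2.
  by field.
split=> [[r0 E]|<-].
  have : derive1 f u ^+ 2 = 1 + eps * ((f u ^+ 2)^-1 * B ^+ 2).
    by rewrite E sqr_sqrtr.
  move=> E2; have E3 : eps * derive1 g u ^+ 2 = eps * ((f u ^+ 2)^-1 * B ^+ 2).
    by move: un; rewrite E2; set X := eps * (_^-1 * _); lra.
  transitivity (f u ^+ 2 * eps * (eps * derive1 g u ^+ 2)).
    by rewrite exprMn mulrA -[f u ^+ 2 * _ * _]mulrA epsK mulr1.
  rewrite E3 -mulrA [eps * (eps * _)]mulrA epsK mul1r.
  by field.
have E : derive1 f u ^+ 2 = 1 + eps * ((f u ^+ 2)^-1 * (f u * derive1 g u) ^+ 2).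
  by rewrite key -un; ring.
by rewrite -E sqrtr_sqr ger0_norm ?df_ge0// sqr_ge0.
Qed.

End MeridianCurve.

(** Both types of surface at once; the second inequality, a domain condition
    on the formula for [y], follows from [eps = 1] in the elliptic case. *)
Lemma meridian_cmc_iff (W : {vspace 'rV[R]_4}) (eps : R) (e : 'rV[R]_4)
    (I J : set R) (f g : R -> R) (l n : R -> 'rV[R]_4) (a : R) :
  eps * eps = 1 -> (forall w, w \in W -> mink w e = 0) -> mink e e = - eps ->
  open_interval I -> open_interval J -> smooth_on I f -> smooth_on I g ->
  (forall u, I u -> 0 < f u) ->
  (forall u, I u -> 0 <= derive1 f u) -> (forall u, I u -> 0 <= derive1 g u) ->
  (forall u, I u -> derive1 f u ^+ 2 - eps * derive1 g u ^+ 2 = 1) ->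
  framed_curve W eps J l n -> general_class I J f g l n -> 0 < a ->
  let z u v := f u *: l v + g u *: e in
  (forall u v, I u -> J v -> epsH z u v = eps /\ mean_curvature z u v = a) <->
  exists b C s, [/\ b != 0, forall v, J v -> spherical_curvature l n v = b &
    forall u, I u -> [/\ 0 <= `|b| ^+ 2 - 4 * a ^+ 2 * f u ^+ 2,
      0 <= 1 + eps * ((f u ^+ 2)^-1 * cmc_bracket a `|b| C s (f u) ^+ 2) &
      derive1 f u =
        Num.sqrt (1 + eps * ((f u ^+ 2)^-1 * cmc_bracket a `|b| C s (f u) ^+ 2))]].
Proof.
move=> epsK We ee [oI iI [u0 Iu0]] [oJ iJ [v0 Jv0]] sf sg f0 df0 dg0 unit cur gc a0 z.
have km0 u : I u -> meridian_curvature f g u != 0.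
  by move=> Iu; have := gc u v0 Iu Jv0; rewrite mulf_eq0 => /norP[].
have k0 v : J v -> spherical_curvature l n v != 0.
  by move=> Jv; have := gc u0 v Iu0 Jv; rewrite mulf_eq0 => /norP[].
have dfp u : I u -> 0 < derive1 f u.
  by move=> /(meridian_derivs_gt0 oI sf sg df0 dg0 km0)[].
have dgp u : I u -> 0 < derive1 g u.
  by move=> /(meridian_derivs_gt0 oI sf sg df0 dg0 km0)[].
have kmE u (Iu : I u) := derive_mul_meridian_curvature oI sf sg unit Iu.
have dfE u (Iu : I u) := smooth_is_derive 0 sf Iu.
have dgE u (Iu : I u) := smooth_is_derive 1 sg Iu.
have HHE u v : I u -> J v -> (epsH z u v = eps /\ mean_curvature z u v = a) <->
    spherical_curvature l n v ^+ 2 = 4 * a ^+ 2 * f u ^+ 2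
      + (f u * meridian_curvature f g u + derive1 g u) ^+ 2.
  move=> Iu Jv; rewrite /mean_curvature /epsH.
  apply: (iff_trans (signed_sqrt_eq (HH z u v) epsK a0)).
  have := meridian_HH epsK We ee oI oJ sf sg f0 unit cur Iu Jv; rewrite -/z.
  set k := spherical_curvature l n v; set w := f u * _ + _ => E.
  have f20 : 4 * f u ^+ 2 != 0 by rewrite mulf_neq0 ?expf_neq0 ?gt_eqF ?f0.
  have e0 : eps != 0 by apply: contra_eq_neq epsK => ->; rewrite mul0r eq_sym oner_eq0.
  split=> [H|H].
    move: E; rewrite H mulrCA => /(mulfI e0) E; rewrite -[LHS](subrK (w ^+ 2)) -E; ring.
  by apply: (mulfI f20); rewrite E H; ring.
split=> [cmc|[b [C [s [b0 kb H]]]] u v Iu Jv].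
  have E u v (Iu : I u) (Jv : J v) := (HHE u v Iu Jv).1 (cmc u v Iu Jv).
  have [s ks] := constant_sign iJ
    (fun v Jv => spherical_curvature_continuous cur Jv) k0.
  set b := spherical_curvature l n v0.
  have kb v : J v -> spherical_curvature l n v = b.
    move=> Jv; rewrite -[LHS](signrMK s) -[RHS](signrMK s); congr (_ * _).
    apply/eqP; rewrite -(eqrXn2 (n := 2)) ?(ltW (ks _ _))//.
    by rewrite !exprMn (@E u0 v)// (@E u0 v0).
  have b0 : b != 0 by exact: k0.
  have [||C [s' H]] := @profile_of_cmc _ I f _ _ _ _ a a0 oI iI dfE dgE f0 dfp kmE
    `|b| _ (ex_intro _ u0 Iu0) (fun u => meridian_expression_continuous sf sg (u:=u)).
  - by rewrite normr_gt0.
  - by move=> u Iu; rewrite real_normK ?num_real// -(@E u v0).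
  exists b, C, s'; split=> // u Iu; have [dom fg] := H u Iu.
  have [] := (profile_slope_iff epsK f0 df0 unit
    (cmc_bracket a `|b| C s' (f u)) Iu).2 (congr1 (fun x => x ^+ 2) fg).
  by split.
apply: (HHE u v Iu Jv).2; rewrite kb// -[b ^+ 2]real_normK ?num_real//.
apply: (@cmc_of_profile _ I f _ _ _ _ a a0 oI iI dfE dgE f0 dfp dgp kmE _ C s) => //.
  by rewrite normr_gt0.
move=> w Iw; have [dom r0 dfw] := H w Iw; split=> //.
by apply/(profile_slope_iff epsK f0 df0 unit _ Iw).
Qed.

Lemma mink_delta (i : 'I_4) (w : 'rV[R]_4) :
  mink (delta_mx 0 i) w = (if i == ord_max then -1 else 1) * w 0 i.
Proof.
rewrite /mink (bigD1 i)//= mxE !eqxx mulr1 big1 ?addr0// => j ji.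
by rewrite mxE (negbTE ji) andbF mulr0 mul0r.
Qed.

Lemma mink_delta_inord (i j : nat) : (i < 4)%N -> (j < 4)%N ->
  mink (delta_mx 0 (inord i)) (delta_mx 0 (inord j)) =
  (if i == 3 then -1 else 1) *+ (i == j) :> R.
Proof.
move=> i4 j4; rewrite mink_delta mxE eqxx /= -!val_eqE /= !inordK//.
by rewrite mulr_natr.
Qed.

Lemma span123_e4 (w : 'rV[R]_4) : w \in span123 R -> mink w (e4 R) = 0.
Proof.
apply: span_orthogonal => x; rewrite !inE => /or3P[] /eqP ->;
by rewrite mink_delta_inord.
Qed.

Lemma span234_e1 (w : 'rV[R]_4) : w \in span234 R -> mink w (e1 R) = 0.
Proof.
apply: span_orthogonal => x; rewrite !inE => /or3P[] /eqP ->;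
by rewrite mink_delta_inord.
Qed.

End Meridian.

(* The value a of the norm ||H|| is nonnegative, so a <> 0 reads 0 < a.
   The condition 0 <= f' fixes the direction of the parameter u (y is a square
   root).  The displayed formula forces <H,H> > 0 in the elliptic case and
   <H,H> < 0 in the hyperbolic one, and its arcsin term is the right primitive
   for the orientation of n making the curvature of c positive, whence
   `|b|: replacing n by -n changes kappa to -kappa but not the surface. *)
Theorem theorem5p1 (R : realType) (I J : set R) (f g : R -> R)
    (l n : R -> 'rV[R]_4) (a : R) (a_gt0 : 0 < a)
    (df_ge0 : forall u, I u -> 0 <= derive1 f u) :
  (elliptic_data I J f g l n ->
   general_class I J f g l n ->
   (forall u v, I u -> J v -> HH (elliptic_surface f g l) u v != 0) ->
   ((forall u v, I u -> J v ->
       epsH (elliptic_surface f g l) u v = 1 /\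
       mean_curvature (elliptic_surface f g l) u v = a)
    <->
    (exists (b C : R) (s : bool),
       [/\ b != 0,
           forall v, J v -> spherical_curvature l n v = b,
           forall u, I u -> y_elliptic_dom a `|b| (f u) /\
                            derive1 f u = y_elliptic a `|b| C s (f u)
         & forall u, I u -> derive1 g u = Num.sqrt (derive1 f u ^+ 2 - 1)])))
  /\
  (hyperbolic_data I J f g l n ->
   general_class I J f g l n ->
   (forall u v, I u -> J v -> HH (hyperbolic_surface f g l) u v != 0) ->
   ((forall u v, I u -> J v ->
       epsH (hyperbolic_surface f g l) u v = -1 /\
       mean_curvature (hyperbolic_surface f g l) u v = a)
    <->
    (exists (b C : R) (s : bool),
       [/\ b != 0,
           forall v, J v -> spherical_curvature l n v = b,
           forall u, I u -> y_hyperbolic_dom a `|b| C s (f u) /\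
                            derive1 f u = y_hyperbolic a `|b| C s (f u)
         & forall u, I u -> derive1 g u = Num.sqrt (1 - derive1 f u ^+ 2)]))).
Proof.
split=> [[iI iJ sf sg f0 unit dgE cur]|[iI iJ sf sg f0 unit dgE cur]] gc _.
  have dg0 u : I u -> 0 <= derive1 g u by move=> Iu; rewrite dgE// sqrtr_ge0.
  have unit' u : I u -> derive1 f u ^+ 2 - 1 * derive1 g u ^+ 2 = 1.
    by move=> Iu; rewrite mul1r unit.
  have ee : mink (e4 R) (e4 R) = -1 by rewrite mink_delta_inord.
  apply: (iff_trans (meridian_cmc_iff (mulr1 1) (@span123_e4 R) ee iI iJ sf sg f0
    df_ge0 dg0 unit' cur gc a_gt0)).
  split=> -[b [C [s H]]]; exists b, C, s.
    case: H => b0 kb H; split=> // u Iu; have [dom _ ->] := H u Iu.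
    by rewrite mul1r.
  case: H => b0 kb H _; split=> // u Iu; have [dom ->] := H u Iu; split=> //.
    by rewrite mul1r addr_ge0// mulr_ge0 ?invr_ge0 ?sqr_ge0.
  by rewrite mul1r.
have dg0 u : I u -> 0 <= derive1 g u by move=> Iu; rewrite dgE// sqrtr_ge0.
have unit' u : I u -> derive1 f u ^+ 2 - -1 * derive1 g u ^+ 2 = 1.
  by move=> Iu; rewrite mulN1r opprK unit.
have ee : mink (e1 R) (e1 R) = - -1 by rewrite mink_delta_inord// opprK.
have N1 : -1 * -1 = 1 :> R by rewrite mulrNN mulr1.
apply: (iff_trans (meridian_cmc_iff N1 (@span234_e1 R) ee iI iJ sf sg f0
  df_ge0 dg0 unit' cur gc a_gt0)).
split=> -[b [C [s H]]]; exists b, C, s.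
  case: H => b0 kb H; split=> // u Iu; have [dom r0 ->] := H u Iu.
  by move: r0; rewrite mulN1r.
case: H => b0 kb H _; split=> // u Iu; have [[dom r0] ->] := H u Iu; split=> //.
  by rewrite mulN1r.
by rewrite mulN1r.
Qed.
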